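(* Let $C_C=V(p^3-q^2)\subset\mathbb{C}^2$ be the cuspidal cubic and let $G_C:\mathbb{C}\to\mathbb{C}^2$, $G_C(z)=((1+z)^2,(1+z)^3)$. For $d\in\mathbb{N}$ let $g_d$ be the Chebyshev-induced morphism on $\mathbb{C}^2/D_3\simeq\mathbb{C}^2$. Then: (1) $g_d(G_C(z))=G_C(T_d(z))$ for all $z\in\mathbb{C}$ and $d\in\mathbb{N}$; (2) $g_d(C_C)=C_C$ for all $d\in\mathbb{N}$.
   Context: $\mathbb{N}=\{1,2,\dots\}$. $T_d(z)$ is the one-variable Chebyshev polynomial with $T_d(s+s^{-1})=s^d+s^{-d}$. Definition of $g_d$: the Chebyshev endomorphism $P_{A_2}^d:\mathbb{C}^2\to\mathbb{C}^2$ is defined by $P_{A_2}^d(e_1(t),e_2(t))=(e_1(t^d),e_2(t^d))$ for $t=(t_1,t_2,t_3)\in(\mathbb{C}^* )^3$ with $t_1t_2t_3=1$, where $t^d=(t_1^d,t_2^d,t_3^d)$ and $e_j$ is the $j$-th elementary symmetric polynomial. With $M_2(x,y)=(x+iy,\,x-iy)$ put $f_d=M_2^{-1}\circ P_{A_2}^d\circ M_2$. The surjective map $\tilde F:\mathbb{C}^2\to\mathbb{C}^2$, $\tilde F(x,y)=(x^2+y^2,\,x^3-3xy^2)$, is the quotient map by the dihedral group $D_3\subset GL(2,\mathbb{R})$ of order 6 generated by the rotation by $2\pi/3$ and $(x,y)\mapsto(x,-y)$; $g_d:\mathbb{C}^2\to\mathbb{C}^2$ (coordinates $(p,q)$) is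 the unique polynomial map with $g_d\circ\tilde F=\tilde F\circ f_d$. *)

(* Defs.v *)
From mathcomp Require Import all_boot all_order all_algebra.
From mathcomp Require Import ring.
From mathcomp Require Import complex.
From mathcomp Require Import boolp classical_sets functions reals.

Set Implicit Arguments.
Unset Strict Implicit.
Unset Printing Implicit Defensive.

Import GRing.Theory Num.Theory.
Local Open Scope ring_scope.
Local Open Scope classical_set_scope.

Section Chebyshev.
Variable R : realType.
Notation C := R[i].
Notation C2 := (C * C)%type.

(* T_d, A2map d and gmap d are each determined by a functional equation.
   [xget dflt P] is an element of [P] as soon as [P] is inhabited, and [dflt]
   otherwise; here each [P] has exactly one element, so [dflt] is irrelevant. *)

Definition is_cheb (d : nat) (T : {poly C}) : Prop :=
  forall s : C, s != 0 -> T.[s + s^-1] = s ^+ d + s^-1 ^+ d.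

Definition cheb (d : nat) : {poly C} := xget 0 [set T | is_cheb d T].

Definition e1 (t1 t2 t3 : C) : C := t1 + t2 + t3.
Definition e2 (t1 t2 t3 : C) : C := t1 * t2 + t1 * t3 + t2 * t3.

(* [t1 * t2 * t3 = 1] already forces the [ti] to be nonzero. *)
Definition is_A2map (d : nat) (P : C2 -> C2) : Prop :=
  forall t1 t2 t3 : C, t1 * t2 * t3 = 1 ->
    P (e1 t1 t2 t3, e2 t1 t2 t3) =
    (e1 (t1 ^+ d) (t2 ^+ d) (t3 ^+ d), e2 (t1 ^+ d) (t2 ^+ d) (t3 ^+ d)).

Definition A2map (d : nat) : C2 -> C2 := xget (id : C2 -> C2) [set P | is_A2map d P].

Definition M2 (v : C2) : C2 := (v.1 + 'i%C * v.2, v.1 - 'i%C * v.2).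
Definition M2inv (w : C2) : C2 := ((w.1 + w.2) / 2, (w.1 - w.2) / (2 * 'i%C)).

Lemma M2K : cancel M2 M2inv.
Proof.
have i0 : ('i%C : C) != 0 by rewrite eq_complex /= oner_eq0 andbF.
by case=> x y; rewrite /M2inv /M2 /=; congr pair; field; rewrite ?i0 ?pnatr_eq0.
Qed.

Lemma M2invK : cancel M2inv M2.
Proof.
have i0 : ('i%C : C) != 0 by rewrite eq_complex /= oner_eq0 andbF.
by case=> x y; rewrite /M2inv /M2 /=; congr pair; field; rewrite ?i0 ?pnatr_eq0.
Qed.

Definition fmap (d : nat) : C2 -> C2 := M2inv \o A2map d \o M2.

Definition tF (v : C2) : C2 :=
  (v.1 ^+ 2 + v.2 ^+ 2, v.1 ^+ 3 - 3 * v.1 * v.2 ^+ 2).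

(* A bivariate polynomial is a polynomial in p with coefficients in C[q]. *)
Definition polynomial_map (g : C2 -> C2) : Prop :=
  exists A B : {poly {poly C}}, forall p q : C,
    g (p, q) = (A.[p%:P].[q], B.[p%:P].[q]).

Definition is_gmap (d : nat) (g : C2 -> C2) : Prop :=
  polynomial_map g /\ g \o tF =1 tF \o fmap d.

Definition gmap (d : nat) : C2 -> C2 := xget (id : C2 -> C2) [set g | is_gmap d g].

Definition cusp : set C2 := [set v | v.1 ^+ 3 - v.2 ^+ 2 = 0].

Definition Gcusp (z : C) : C2 := ((1 + z) ^+ 2, (1 + z) ^+ 3).

End Chebyshev.

Arguments cheb R d : clear implicits.
Arguments cusp R : clear implicits.

(* Main.v *)
Require Import Defs.
From mathcomp Require Import all_boot all_order all_algebra.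
From mathcomp Require Import ring.
From mathcomp Require Import complex.
From mathcomp Require Import boolp classical_sets functions reals.
Local Open Scope ring_scope.
Local Open Scope classical_set_scope.
Import GRing.Theory Num.Theory.

(** The cusp is the image under [tF] of the line [y = 0], on which [M2] takes
    the values [(1 + z, 1 + z)].  Writing [z = s + s^-1], this is
    [(e1 t, e2 t)] for [t = (s, s^-1, 1)], so [f_d] maps [(1 + z, 0)] to
    [(1 + T_d z, 0)], whence (1); (2) follows since [T_d] is surjective.

    That [g_d] exists is seen in the coordinates [u = x + iy], [v = x - iy],
    where [tF] is [(u v, (u^3 + v^3) / 2)].  The first component of the
    Chebyshev endomorphism is a polynomial [psum d] in [u, v], the second is
    [psum d] with [u] and [v] exchanged.  If [u] has weight 1 and [v] weight 2
    modulo 3, then [psum d] has weight [d], and over [C[u v, u^3 + v^3]] the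
    polynomials of weight 0, 1, 2 are generated by [1, u^3], by [u, v^2] and by
    [v, u^2].  Expanding the product and the sum of the cubes of such a
    polynomial and of its mirror image gives polynomials in [u v] and
    [u^3 + v^3]. *)

(** * Power sums of three numbers with product 1 *)

Section PowerSums.
Variable A : comNzRingType.

(** Newton's recurrence for power sums in three variables, with [u], [v], 1 as elementary symmetric
    polynomials. *)
Fixpoint psum (d : nat) (u v : A) : A :=
  match d with
  | 0 => 3
  | 1 => u
  | 2 => u ^+ 2 - 2 * v
  | S (S (S k as k1) as k2) => u * psum k2 u v - v * psum k1 u v + psum k u v
  end.

Lemma psumSSS d u v :
  psum d.+3 u v = u * psum d.+2 u v - v * psum d.+1 u v + psum d u v.
Proof. by []. Qed.

Lemma psumE d (t1 t2 t3 : A) : t1 * t2 * t3 = 1 ->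
  psum d (t1 + t2 + t3) (t1 * t2 + t1 * t3 + t2 * t3) =
  t1 ^+ d + t2 ^+ d + t3 ^+ d.
Proof.
move=> t1t2t3.
set u := t1 + t2 + t3; set v := _ + t2 * t3.
suff: [/\ psum d u v = t1 ^+ d + t2 ^+ d + t3 ^+ d,
          psum d.+1 u v = t1 ^+ d.+1 + t2 ^+ d.+1 + t3 ^+ d.+1 &
          psum d.+2 u v = t1 ^+ d.+2 + t2 ^+ d.+2 + t3 ^+ d.+2] by case.
elim: d => [|d [IH0 IH1 IH2]].
  by split; rewrite /= /u /v; ring.
split=> //; rewrite psumSSS IH0 IH1 IH2.
(* With [t1 * t2 * t3] as coefficient of the last power sum, the recurrence is an identity in free
   variables. *)
rewrite -[X in _ + X]mul1r -t1t2t3 /u /v !exprS; ring.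
Qed.

(** The pairwise products again multiply to 1, and their second elementary symmetric polynomial is
    [t1 * t2 * t3] times [t1 + t2 + t3]. *)
Lemma psum_swapE d (t1 t2 t3 : A) : t1 * t2 * t3 = 1 ->
  psum d (t1 * t2 + t1 * t3 + t2 * t3) (t1 + t2 + t3) =
  (t1 * t2) ^+ d + (t1 * t3) ^+ d + (t2 * t3) ^+ d.
Proof.
move=> t1t2t3; rewrite -psumE; last first.
  by rewrite -[RHS](mulr1 1) -{1}t1t2t3 -t1t2t3; ring.
congr psum; rewrite -[LHS]mul1r -t1t2t3; ring.
Qed.

End PowerSums.

(** * Solving polynomial equations over an algebraically closed field *)

Section ClosedField.
Variable F : closedFieldType.

Lemma closed_exprn_surj d (a : F) : (0 < d)%N -> exists s, s ^+ d = a.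
Proof.
move=> d_gt0.
have /closed_rootP[s] : size ('X^d - a%:P : {poly F}) != 1%N.
  by rewrite size_XnsubC // eqSS -lt0n.
rewrite rootE !hornerE subr_eq0 => /eqP sa; by exists s.
Qed.

Lemma closed_vieta2 (a b : F) : exists x y, x + y = a /\ x * y = b.
Proof.
pose p : {poly F} := 'X^2 + (b%:P - a *: 'X).
have /closed_rootP[x] : size p != 1%N.
  rewrite size_polyDl size_polyXn //.
  rewrite (leq_ltn_trans (size_polyD _ _)) // gtn_max size_polyN.
  rewrite (leq_ltn_trans (size_polyC_leq1 _)) //.
  by rewrite (leq_ltn_trans (size_scale_leq _ _)) ?size_polyX.
rewrite rootE !hornerE /= => /eqP px.
exists x, (a - x); split; first by rewrite subrKC.
by apply/eqP; rewrite eq_sym -subr_eq0 -px; apply/eqP; ring.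
Qed.

Lemma closed_add_inv_surj (z : F) : exists2 s, s != 0 & s + s^-1 = z.
Proof.
have [x [y [xyz xy1]]] := closed_vieta2 z 1.
have x0 : x != 0 by apply: contra_eq_neq xy1 => ->; rewrite mul0r eq_sym oner_neq0.
exists x => //; rewrite -xyz; congr (_ + _).
by apply: (mulfI x0); rewrite divff.
Qed.

(** These are the roots of [X^3 - u X^2 + v X - 1]: after one root [t], the other two have sum
    [u - t] and product [t^-1]. *)
Lemma closed_vieta3 (u v : F) : exists t1 t2 t3,
  [/\ t1 * t2 * t3 = 1, t1 + t2 + t3 = u & t1 * t2 + t1 * t3 + t2 * t3 = v].
Proof.
pose p : {poly F} := 'X^3 + (v *: 'X - u *: 'X^2 - 1).
have /closed_rootP[t] : size p != 1%N.
  rewrite size_polyDl size_polyXn //.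
  rewrite (leq_ltn_trans (size_polyD _ _)) // gtn_max size_polyN size_poly1 andbT.
  rewrite (leq_ltn_trans (size_polyD _ _)) // gtn_max size_polyN.
  by rewrite !(leq_ltn_trans (size_scale_leq _ _)) ?size_polyX ?size_polyXn.
rewrite rootE !hornerE /= => /eqP pt.
have tq : t * (t ^+ 2 - u * t + v) = 1.
  by apply/eqP; rewrite -subr_eq0 -pt; apply/eqP; ring.
have t0 : t != 0 by apply: contra_eq_neq tq => ->; rewrite mul0r eq_sym oner_neq0.
have [x [y [xDy xMy]]] := closed_vieta2 (u - t) t^-1.
exists t, x, y; split; first by rewrite -mulrA xMy divff.
  by rewrite -addrA xDy subrKC.
rewrite -mulrDr xDy xMy.
have -> : t^-1 = t ^+ 2 - u * t + v by apply: (mulfI t0); rewrite tq divff.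
ring.
Qed.

End ClosedField.

(** * Weights modulo 3 and invariants *)

Section Weights.
Variable F : fieldType.
Hypothesis two_neq0 : (2 : F) != 0.
Implicit Types f g h : F -> F -> F.

Definition bipoly f := exists A : {poly {poly F}}, forall p q, f p q = A.[p%:P].[q].

Lemma bipoly_cst c : bipoly (fun _ _ => c).
Proof. by exists c%:P%:P => p q; rewrite !hornerE. Qed.

Lemma bipoly_fst : bipoly (fun p _ => p).
Proof. by exists 'X => p q; rewrite !hornerE. Qed.

Lemma bipoly_snd : bipoly (fun _ q => q).
Proof. by exists 'X%:P => p q; rewrite !hornerE. Qed.

Lemma bipolyD f g : bipoly f -> bipoly g -> bipoly (fun p q => f p q + g p q).
Proof. by move=> [A fA] [B gB]; exists (A + B) => p q; rewrite !hornerE fA gB. Qed.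

Lemma bipolyN f : bipoly f -> bipoly (fun p q => - f p q).
Proof. by move=> [A fA]; exists (- A) => p q; rewrite !hornerE fA. Qed.

Lemma bipolyM f g : bipoly f -> bipoly g -> bipoly (fun p q => f p q * g p q).
Proof. by move=> [A fA] [B gB]; exists (A * B) => p q; rewrite !hornerE fA gB. Qed.

Lemma bipolyX f n : bipoly f -> bipoly (fun p q => f p q ^+ n).
Proof. by move=> [A fA]; exists (A ^+ n) => p q; rewrite !hornerE fA. Qed.

Fixpoint gen (r : nat) : (F -> F -> F) * (F -> F -> F) :=
  match r with
  | 0 => (fun _ _ => 1, fun u _ => u ^+ 3)
  | 1 => (fun u _ => u, fun _ v => v ^+ 2)
  | 2 => (fun _ v => v, fun u _ => u ^+ 2)
  | S (S (S k)) => gen k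
  end.

Definition has_weight (r : nat) h := exists f g, [/\ bipoly f, bipoly g &
  forall u v, h u v = f (u * v) ((u ^+ 3 + v ^+ 3) / 2) * (gen r).1 u v
                    + g (u * v) ((u ^+ 3 + v ^+ 3) / 2) * (gen r).2 u v].

(** Matches the period 3 of [gen], so that induction steps about weights hold by conversion. *)
Lemma nat_ind3 (P : nat -> Prop) :
  P 0 -> P 1 -> P 2 -> (forall n, P n -> P n.+3) -> forall n, P n.
Proof.
move=> P0 P1 P2 PS n; suff: [/\ P n, P n.+1 & P n.+2] by case.
by elim: n => [|n [Pn Pn1 Pn2]]; split=> //; apply: PS.
Qed.

Lemma has_weightD r h1 h2 : has_weight r h1 -> has_weight r h2 ->
  has_weight r (fun u v => h1 u v + h2 u v).
Proof.
move=> [f1 [g1 [f1P g1P h1E]]] [f2 [g2 [f2P g2P h2E]]].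
exists (fun p q => f1 p q + f2 p q), (fun p q => g1 p q + g2 p q).
split; [exact: bipolyD | exact: bipolyD | move=> u v].
by rewrite h1E h2E; ring.
Qed.

Lemma has_weightN r h : has_weight r h -> has_weight r (fun u v => - h u v).
Proof.
move=> [f [g [fP gP hE]]].
exists (fun p q => - f p q), (fun p q => - g p q).
by split; [exact: bipolyN | exact: bipolyN | move=> u v; rewrite hE; ring].
Qed.

Ltac bipoly_tac := by do ?[assumption | apply: bipoly_cst | apply: bipoly_fst
  | apply: bipoly_snd | apply: bipolyN | apply: bipolyD | apply: bipolyM
  | apply: bipolyX].

(** Since [u * v] and [u ^+ 3 + v ^+ 3] are symmetric, [h u v] and [h v u] share their coefficients,
    which can be generalized. *)
Ltac weight_field f g hE := let u := fresh in let v := fresh in move=> u v;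
  rewrite !hE /= ?[v * u]mulrC ?[v ^+ 3 + _]addrC;
  let a := fresh in let b := fresh in move: (f _ _) (g _ _) => a b; by field.

Lemma has_weightMl r h : has_weight r h -> has_weight r.+1 (fun u v => u * h u v).
Proof.
elim/nat_ind3: r => [|||//] [f [g [fP gP hE]]].
(* From [u^4 = 2 q u - p v^2]. *)
- exists (fun p q => f p q + 2 * q * g p q), (fun p q => - (p * g p q)).
  split; [bipoly_tac | bipoly_tac | weight_field f g hE].
- exists (fun p q => p * g p q), f.
  split; [bipoly_tac | bipoly_tac | weight_field f g hE].
- exists (fun p q => p * f p q), g.
  split; [bipoly_tac | bipoly_tac | weight_field f g hE].
Qed.

Lemma has_weightMr r h : has_weight r h -> has_weight r.+2 (fun u v => v * h u v).
Proof.
elim/nat_ind3: r => [|||//] [f [g [fP gP hE]]].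
- exists f, (fun p q => p * g p q).
  split; [bipoly_tac | bipoly_tac | weight_field f g hE].
(* From [v^3 = 2 q - u^3]. *)
- exists (fun p q => p * f p q + 2 * q * g p q), (fun p q => - g p q).
  split; [bipoly_tac | bipoly_tac | weight_field f g hE].
- exists (fun p q => p * g p q), f.
  split; [bipoly_tac | bipoly_tac | weight_field f g hE].
Qed.

Lemma psum_has_weight d : has_weight d (psum F d).
Proof.
suff: [/\ has_weight d (psum F d), has_weight d.+1 (psum F d.+1) &
          has_weight d.+2 (psum F d.+2)] by case.
elim: d => [|d [IH0 IH1 IH2]].
  split; [exists (fun _ _ => 3), (fun _ _ => 0) | exists (fun _ _ => 1), (fun _ _ => 0)
    | exists (fun _ _ => - 2), (fun _ _ => 1)]; split;
    do ?[exact: bipoly_cst | by move=> u v /=; ring].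
split=> //.
(* All three terms of the recurrence have weight [d.+3], which for [gen] is convertible with [d]. *)
have := has_weightD _ _ _ (has_weightD _ _ _ (has_weightMl _ _ IH2)
  (has_weightN _ _ (has_weightMr _ _ IH1))) IH0.
exact.
Qed.

Lemma has_weight_mul_swap r h : has_weight r h ->
  exists2 N, bipoly N & forall u v,
    h u v * h v u = N (u * v) ((u ^+ 3 + v ^+ 3) / 2).
Proof.
elim/nat_ind3: r => [|||//] [f [g [fP gP hE]]].
- exists (fun p q => f p q ^+ 2 + 2 * q * f p q * g p q + p ^+ 3 * g p q ^+ 2).
    bipoly_tac.
  weight_field f g hE.
- exists (fun p q => p * f p q ^+ 2 + 2 * q * f p q * g p q + p ^+ 2 * g p q ^+ 2).
    bipoly_tac.
  weight_field f g hE.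
- exists (fun p q => p * f p q ^+ 2 + 2 * q * f p q * g p q + p ^+ 2 * g p q ^+ 2).
    bipoly_tac.
  weight_field f g hE.
Qed.

Lemma has_weight_cube_swap r h : has_weight r h ->
  exists2 N, bipoly N & forall u v,
    (h u v ^+ 3 + h v u ^+ 3) / 2 = N (u * v) ((u ^+ 3 + v ^+ 3) / 2).
Proof.
elim/nat_ind3: r => [|||//] [f [g [fP gP hE]]].
(* Here [(u^6 + v^6) / 2 = 2 q^2 - p^3] and [(u^9 + v^9) / 2 = 4 q^3 - 3 p^3 q]. *)
- exists (fun p q => f p q ^+ 3 + 3 * q * f p q ^+ 2 * g p q
    + 3 * (2 * q ^+ 2 - p ^+ 3) * f p q * g p q ^+ 2
    + (4 * q ^+ 3 - 3 * p ^+ 3 * q) * g p q ^+ 3).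
    bipoly_tac.
  weight_field f g hE.
- exists (fun p q => q * f p q ^+ 3 + 3 * p ^+ 2 * f p q ^+ 2 * g p q
    + 3 * p * q * f p q * g p q ^+ 2 + (2 * q ^+ 2 - p ^+ 3) * g p q ^+ 3).
    bipoly_tac.
  weight_field f g hE.
- exists (fun p q => q * f p q ^+ 3 + 3 * p ^+ 2 * f p q ^+ 2 * g p q
    + 3 * p * q * f p q * g p q ^+ 2 + (2 * q ^+ 2 - p ^+ 3) * g p q ^+ 3).
    bipoly_tac.
  weight_field f g hE.
Qed.

End Weights.

(** * The Chebyshev maps and the cuspidal cubic *)

Section ChebyshevMaps.
Variable R : realType.
Local Notation C := R[i].

Let two_neq0 : (2 : C) != 0. Proof. by rewrite pnatr_eq0. Qed.

Lemma cheb_exists d : exists T : {poly C}, is_cheb d T.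
Proof.
suff: exists T U : {poly C}, is_cheb d T /\ is_cheb d.+1 U by move=> [T [U [TP _]]]; exists T.
elim: d => [|d [T [U [TP UP]]]].
  by exists 2, 'X; split=> s s0; rewrite !hornerE ?expr0.
(* The Chebyshev recurrence, started at [2] and ['X]. *)
exists U, ('X * U - T); split=> // s s0.
rewrite !hornerE TP ?UP // !exprS.
by field.
Qed.

Lemma chebP d : is_cheb d (cheb R d).
Proof. by have [T] := cheb_exists d; exact: xgetI. Qed.

Lemma is_A2map_psum d : is_A2map d (fun w : C * C => (psum C d w.1 w.2, psum C d w.2 w.1)).
Proof.
move=> t1 t2 t3 t1t2t3; rewrite /e1 /e2 /= psumE // psum_swapE //.
by rewrite !exprMn.
Qed.

Lemma A2mapP d : is_A2map d (@A2map R d).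
Proof. exact: (xgetI _ (is_A2map_psum d)). Qed.

(** Every point is [(e1 t, e2 t)] for some [t] with product 1, so the functional equation fixes all
    values. *)
Lemma A2mapE d (u v : C) : A2map d (u, v) = (psum C d u v, psum C d v u).
Proof.
have [t1 [t2 [t3 [t1t2t3 <- <-]]]] := closed_vieta3 C u v.
by rewrite (A2mapP d t1 t2 t3 t1t2t3) (is_A2map_psum d t1 t2 t3 t1t2t3).
Qed.

Lemma tF_M2inv (w : C * C) : tF (M2inv w) = (w.1 * w.2, (w.1 ^+ 3 + w.2 ^+ 3) / 2).
Proof.
have i0 : ('i%C : C) != 0 by rewrite eq_complex /= oner_eq0 andbF.
have i2 : ('i%C : C) ^+ 2 = -1 by rewrite sqr_i.
rewrite /tF /M2inv /=.
(* With ['i] out of the denominator, only its square occurs below. *)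
have -> : (w.1 - w.2) / (2 * 'i%C) = - ('i%C * (w.1 - w.2) / 2).
  rewrite -[LHS]mul1r -[1]opprK -i2; by field; rewrite ?i0.
by rewrite sqrrN !exprMn i2 ; congr pair; field.
Qed.

Lemma gmap_exists d : exists g : C * C -> C * C, is_gmap d g.
Proof.
have [N1 [A N1E] mulE] := has_weight_mul_swap _ two_neq0 _ _ (psum_has_weight _ two_neq0 d).
have [N2 [B N2E] cubE] := has_weight_cube_swap _ two_neq0 _ _ (psum_has_weight _ two_neq0 d).
exists (fun w => (N1 w.1 w.2, N2 w.1 w.2)); split.
  by exists A, B => p q /=; rewrite N1E N2E.
move=> v; rewrite -(M2K v); case: (M2 v) => x y.
rewrite /fmap /= M2invK A2mapE [in RHS]tF_M2inv /= mulE cubE.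
by case: (tF_M2inv (x, y)) => -> ->.
Qed.

Lemma gmap_tF d (v : C * C) : gmap d (tF v) = tF (fmap d v).
Proof.
have [g gP] := gmap_exists d.
by have [_ /(_ v)] := xgetI (id : C * C -> C * C) gP.
Qed.

Lemma gmap_Gcusp d (z : C) : gmap d (Gcusp z) = Gcusp (cheb R d).[z].
Proof.
have Gcusp_tF (y : C) : Gcusp y = tF (1 + y, 0).
  by rewrite /Gcusp /tF /= !expr0n !mulr0 addr0 subr0.
rewrite !Gcusp_tF gmap_tF; congr tF.
have [s s0 <-] := closed_add_inv_surj C z.
rewrite chebP // -[RHS]M2K /fmap /=; congr M2inv.
rewrite /M2 /= !mulr0 !addr0 !subr0.
have := A2mapP d s s^-1 1; rewrite /e1 /e2 mulr1 divff // => /(_ erefl).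
rewrite !mulr1 -exprMn divff // expr1n => H.
rewrite [1 + (s + _)]addrC {2}[_ + 1]addrC addrA H.
by congr pair; ring.
Qed.

(** If [z = s + s^-1] and [r ^+ d = s], then [r + r^-1] is a preimage. *)
Lemma cheb_surj d (z : C) : (0 < d)%N -> exists y, (cheb R d).[y] = z.
Proof.
move=> d_gt0; have [s s0 <-] := closed_add_inv_surj C z.
have [r rs] := closed_exprn_surj C d s d_gt0.
have r0 : r != 0 by apply: contraNneq s0 => r0; rewrite -rs r0 expr0n gtn_eqF.
by exists (r + r^-1); rewrite chebP // exprVn rs.
Qed.

Lemma range_Gcusp : range (@Gcusp R) = cusp R.
Proof.
apply/seteqP; split=> [_ [z _ <-]|[x y] /= /eqP].
  by rewrite /cusp /Gcusp /= -!exprM subrr.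
rewrite subr_eq0 /= => /eqP xy; have [x0|x0] := eqVneq x 0.
  (* The parameter [1 + z] is 0 at the cusp point and the slope [y / x] elsewhere. *)
  exists (-1) => //; move: xy; rewrite /Gcusp x0 subrr !expr0n /= => /esym/eqP.
  by rewrite sqrf_eq0 => /eqP ->.
exists (y / x - 1) => //; rewrite /Gcusp addrC subrK.
congr pair; rewrite expr_div_n; first by rewrite -xy; field.
by rewrite exprS -xy; field.
Qed.

End ChebyshevMaps.

Theorem theorem3p7 (R : realType) :
  (forall d : nat, (0 < d)%N -> forall z : R[i],
     gmap d (Gcusp z) = Gcusp (cheb R d).[z]) /\
  (forall d : nat, (0 < d)%N -> gmap d @` cusp R = cusp R).
Proof.
split=> [d _ z|d d_gt0]; first exact: gmap_Gcusp.
rewrite -range_Gcusp; apply/seteqP; split=> [_ [_ [z _ <-] <-]|_ [z _ <-]].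
  by rewrite gmap_Gcusp; exists (cheb R d).[z].
have [y <-] := cheb_surj R d z d_gt0.
by exists (Gcusp y); [exists y | exact: gmap_Gcusp].
Qed.
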